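(* For any number $k\in\mathbb{N}$ and any sequence $\{(\lambda_n,\beta_n)\}\subset(0,\infty)\times(0,1]$ such that $(\lambda_n,\beta_n)\to(\lambda_*,\beta_* )\in\{0\}\times(0,1]$, there exists no sequence $(u_n)$ such that $u_n\in S_{k,\lambda_n,\beta_n}$ for all $n\in\mathbb{N}$ and $\int_B|\nabla u_n|^2dx$ is uniformly bounded for all $n\in\mathbb{N}$.
   Context: $B\subset\mathbb{R}^2$ is the open unit ball centered at the origin, $\alpha>0$ is fixed, $\mathbb{N}=\{1,2,\dots\}$. For $(\lambda,\beta)\in(0,\infty)\times(0,2)$ consider \[ -\Delta u=\lambda ue^{u^2+\alpha|u|^\beta}\ \text{in }B,\qquad u=0\ \text{on }\partial B. \qquad (P_{\lambda,\beta}) \] For $k\in\{0\}\cup\mathbb{N}$, $S_{k,\lambda,\beta}$ is the set of radial solutions $u\in C^2(B)\cap C^0(\overline{B})$ of $(P_{\lambda,\beta})$ for which there are numbers $0=r_0<r_1<\dots<r_{k+1}=1$ such that, for all $1\le i\le k+1$, $u(x)=0$ if $|x|=r_i$ and $\mathrm{sgn}(u(0))(-1)^{i-1}u>0$ on $\{r_{i-1}<|x|<r_i\}$. *)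

(* Defs.v *)
From HB Require Import structures.
From mathcomp Require Import all_boot all_order all_algebra.
From mathcomp Require Import all_classical all_reals all_analysis.
Set Implicit Arguments.
Unset Strict Implicit.
Unset Printing Implicit Defensive.
Import Order.TTheory GRing.Theory Num.Theory.
Import numFieldNormedType.Exports.
Local Open Scope classical_set_scope.
Local Open Scope ring_scope.

(* Functions on a subset of the plane are total functions on R * R; every
   condition below only depends on their values on the closed unit disk. *)

(* The library norm on R * R is the sup norm, hence this definition. *)
Definition enorm {R : realType} (p : R * R) : R :=
  Num.sqrt (p.1 ^+ 2 + p.2 ^+ 2).

Definition disk {R : realType} : set (R * R) := [set p | enorm p < 1].

Definition cdisk {R : realType} : set (R * R) := [set p | enorm p <= 1].

Definition dx {R : realType} (u : R * R -> R) : R * R -> R :=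
  fun p => 'D_((1, 0) : R * R) u p.

Definition dy {R : realType} (u : R * R -> R) : R * R -> R :=
  fun p => 'D_((0, 1) : R * R) u p.

(* u is of class C^m on the open set U: all iterated partial derivatives of
   order at most m exist and are continuous on U. *)
Fixpoint Ck_on {R : realType} (U : set (R * R)) (m : nat) (u : R * R -> R)
    : Prop :=
  (forall p, U p -> {for p, continuous u}) /\
  if m is m'.+1 then
    [/\ forall p, U p -> derivable u p ((1, 0) : R * R),
        forall p, U p -> derivable u p ((0, 1) : R * R),
        Ck_on U m' (dx u) & Ck_on U m' (dy u)]
  else True.

Definition laplacian {R : realType} (u : R * R -> R) : R * R -> R :=
  fun p => dx (dx u) p + dy (dy u) p.

Definition radial {R : realType} (u : R * R -> R) : Prop :=
  forall p q, cdisk p -> cdisk q -> enorm p = enorm q -> u p = u q.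

Definition solution {R : realType} (alpha lambda beta : R)
    (u : R * R -> R) : Prop :=
  [/\ Ck_on disk 2 u,
      {within cdisk, continuous u},
      forall p, disk p ->
        - laplacian u p
        = lambda * u p * expR (u p ^+ 2 + alpha * (`|u p| `^ beta)) &
      forall p, enorm p = 1 -> u p = 0].

(* The interval of index i here is the one of index i + 1 in the usual
   numbering 1 <= i <= k + 1; values r i with k + 1 < i play no role. *)
Definition nodal {R : realType} (k : nat) (u : R * R -> R) : Prop :=
  exists r : nat -> R,
    [/\ r 0%N = 0, r k.+1 = 1,
        forall i, (i <= k)%N -> r i < r i.+1,
        forall i p, (i <= k)%N -> enorm p = r i.+1 -> u p = 0 &
        forall i p, (i <= k)%N -> r i < enorm p < r i.+1 ->
          0 < Num.sg (u (0, 0)) * (-1) ^+ i * u p].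

Definition S_ {R : realType} (alpha : R) (k : nat) (lambda beta : R)
    : set (R * R -> R) :=
  [set u | [/\ solution alpha lambda beta u, radial u & nodal k u]].

(* \int_B |grad u|^2, as an extended real *)
Definition dirichlet {R : realType} (u : R * R -> R) : \bar R :=
  (\int[lebesgue_measure \x lebesgue_measure]_(p in disk)
     ((dx u p) ^+ 2 + (dy u p) ^+ 2)%:E)%E.

(* Main.v *)
Require Import Defs.
From mathcomp Require Import all_boot all_order all_algebra.
From mathcomp Require Import ring lra.
From mathcomp Require Import all_classical all_reals all_analysis.
Import Order.TTheory GRing.Theory Num.Theory.
Import numFieldNormedType.Exports.
Local Open Scope classical_set_scope.
Local Open Scope ring_scope.

(** For [0 < beta <= 1] and [k >= 1] the set [S_ alpha k lambda beta] is empty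
    as soon as [lambda] lies below a threshold that depends on [alpha] only
    ([nodal_lambda_lower_bound]); hence no sequence of such solutions can have
    [lambda n --> 0].  The reason is the following.

    Along a radius, a solution [g] has a flux [P = - r g'] with
    [P' = lam r f(g)], where [f u = u exp (u^2 + alpha |u|^beta)].  Up to a
    sign, [mu = g 0] is positive; let [r1 < r2] be the first two zeros.

    If [|g| <= M] on a nodal interval, then [f(g) / g] is at most
    [slope_bound c M] there, and when [lam] times this bound is at most [2] the
    solution cannot come back to zero ([weak_load_end_gt0]).  So for small
    [lam] each of the first two nodal intervals reaches a prescribed height.
    For the first one this makes [mu] large, and the claim is that the
    second one then stays below a constant, which is absurd.

    When [mu] is large, the solution concentrates at the origin.  In the
    variable [log r] it has the profile of a Liouville bubble, across which the
    flux climbs from [0] to about [2 / mu]; afterwards [g] falls almost linearly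
    in [log r].  Two estimates follow.
    - [lam r1^2 >= exp (- D mu)] ([eigenvalue_lower]).  The quantity
      [log (lam r^2) + g^2] is [O(mu)] at the bubble, and along the linear
      descent [g^2] is traded for [2 log r] with an error [O(mu)].  Here
      [beta <= 1] is essential: it keeps the contribution of
      [alpha |u|^beta] within [O(mu)].
    - [P r1 <= 4 / mu + O(lam r1^2)] ([exit_flux]): past the bubble the flux
      grows only close to [r1], where [g] is bounded.

    On the second nodal interval [|g|] is concave in [log r] and leaves zero
    with slope [P r1], hence [|g| <= P r1 log (1 / r1)].  By the first estimate
    [log (1 / (lam r1^2))] is [O(mu)], and it is also at most
    [1 / (lam r1^2)]; the two terms of the second estimate compensate exactly
    these two bounds, and [P r1 log (1 / r1)] is bounded by a constant
    ([exit_flux_log]).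

    The estimates near the bubble all come from monotone quantities built from
    [g], [P] and the source [p = lam r^2 f(g)].  With
    [f' = h f] one has [r P' = p], [r g' = - P] and [r p' = p (2 - h P)], where
    [2 u <= h <= 2 u + c] for [u >= 1]. *)

Set Implicit Arguments.
Unset Strict Implicit.
Unset Printing Implicit Defensive.

(** * One-variable calculus *)

Section calculus.
Variable R : realType.
Implicit Types (f g : R -> R) (x : R).

(** The rules of differentiation and continuity for functions written
    [fun t => E t], so that the shape of [E] selects the rule. *)
Lemma is_derive_cstf (a x : R) : is_derive x 1 (fun=> a) 0.
Proof. exact: is_derive_cst. Qed.

Lemma is_derive_idf x : is_derive x 1 (fun t => t) 1.
Proof. exact: is_derive_id. Qed.

Lemma is_derive_addf f g x a b : is_derive x 1 f a -> is_derive x 1 g b ->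
  is_derive x 1 (fun t => f t + g t) (a + b).
Proof. by move=> ? ?; apply: is_deriveD. Qed.

Lemma is_derive_oppf f x a : is_derive x 1 f a -> is_derive x 1 (fun t => - f t) (- a).
Proof. by move=> ?; apply: is_deriveN. Qed.

Lemma is_derive_mulf f g x a b : is_derive x 1 f a -> is_derive x 1 g b ->
  is_derive x 1 (fun t => f t * g t) (f x * b + g x * a).
Proof. by move=> ? ?; apply: is_deriveM. Qed.

Lemma is_derive_sqrf f x a : is_derive x 1 f a ->
  is_derive x 1 (fun t => f t ^+ 2) (2 * f x * a).
Proof.
move=> fa; have -> : (fun t => f t ^+ 2) = (fun t => f t * f t).
  by apply/funext => t; rewrite expr2.
by apply: is_derive_eq (is_derive_mulf fa fa) _; ring.
Qed.

Lemma is_derive_compf f g x a b : is_derive (g x) 1 f a -> is_derive x 1 g b ->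
  is_derive x 1 (fun t => f (g t)) (a * b).
Proof. by move=> fa gb; exact: (is_derive1_comp fa gb). Qed.

Lemma is_derive_invf f x a : f x != 0 -> is_derive x 1 f a ->
  is_derive x 1 (fun t => (f t)^-1) (- a / f x ^+ 2).
Proof.
move=> f0 fa; apply: is_derive_eq (is_deriveV f0 fa) _.
by rewrite /GRing.scale/=; field.
Qed.

Lemma is_derive_expRf f x a : is_derive x 1 f a ->
  is_derive x 1 (fun t => expR (f t)) (expR (f x) * a).
Proof. by move=> fa; exact: is_derive_compf. Qed.

Lemma continuous_cstf (a x : R) : {for x, continuous (fun _ : R => a)}.
Proof. exact: cvg_cst. Qed.

Lemma continuous_idf x : {for x, continuous (fun t : R => t)}.
Proof. exact: cvg_id. Qed.

Lemma continuous_addf f g x : {for x, continuous f} -> {for x, continuous g} ->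
  {for x, continuous (fun t => f t + g t)}.
Proof. exact: cvgD. Qed.

Lemma continuous_oppf f x : {for x, continuous f} ->
  {for x, continuous (fun t => - f t)}.
Proof. exact: cvgN. Qed.

Lemma continuous_mulf f g x : {for x, continuous f} -> {for x, continuous g} ->
  {for x, continuous (fun t => f t * g t)}.
Proof. exact: cvgM. Qed.

Lemma continuous_sqrf f x : {for x, continuous f} ->
  {for x, continuous (fun t => f t ^+ 2)}.
Proof.
move=> cf; have -> : (fun t => f t ^+ 2) = (fun t => f t * f t).
  by apply/funext => t; rewrite expr2.
exact: continuous_mulf.
Qed.

Lemma continuous_expRf f x : {for x, continuous f} ->
  {for x, continuous (fun t => expR (f t))}.
Proof. by move=> cf; apply: continuous_comp cf _; exact: continuous_expR. Qed.

Lemma is_derive_continuous f x a : is_derive x 1 f a -> {for x, continuous f}.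
Proof.
by move=> [df _]; apply/differentiable_continuous/derivable1_diffP.
Qed.

Lemma within_itv_continuous f (a b : R) :
  (forall x, a <= x <= b -> {for x, continuous f}) ->
  {within `[a, b], continuous f}.
Proof.
move=> cf; apply: continuous_in_subspaceT => x.
by rewrite inE /= in_itv /= => /cf.
Qed.

Lemma nondecreasing_within f (a b : R) : a <= b ->
  {within `[a, b], continuous f} ->
  (forall x, a < x < b -> exists2 d : R, is_derive x 1 f d & 0 <= d) ->
  f a <= f b.
Proof.
rewrite le_eqVlt => /predU1P[-> //|ab] cf df.
have df' x : x \in `]a, b[ -> is_derive x 1 f ('D_1 f x).
  by rewrite in_itv /= => /df[d [fx _] _]; exact: derivableP.
have [c] := MVT ab df' cf.
rewrite in_itv /= => /df[d [_ <-] d0] fba.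
by rewrite -subr_ge0 fba mulr_ge0// subr_ge0 ltW.
Qed.

(** The quantities below are differentiable at positive radii but only
    continuous at the origin; at any other left end point continuity follows
    from differentiability. *)
Lemma nondecreasing_from f (a b : R) : 0 <= a <= b ->
  (a = 0 -> {for 0, continuous f}) ->
  (forall x, 0 < x -> a <= x <= b -> exists2 d : R, is_derive x 1 f d & 0 <= d) ->
  f a <= f b.
Proof.
move=> /andP[a0 ab] cf df; apply: nondecreasing_within => // [|x xab].
  apply: within_itv_continuous => x xab.
  have [x0|x0] := ltP 0 x.
    by have [d dx _] := df x x0 xab; exact: is_derive_continuous dx.
  have xe : x = 0 by lra.
  by rewrite xe; apply: cf; lra.
by apply: df; lra.
Qed.

Lemma nonincreasing_from f (a b : R) : 0 <= a <= b ->
  (a = 0 -> {for 0, continuous f}) ->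
  (forall x, 0 < x -> a <= x <= b -> exists2 d : R, is_derive x 1 f d & d <= 0) ->
  f b <= f a.
Proof.
move=> ab cf df; rewrite -lerN2; apply: (@nondecreasing_from (fun t => - f t)) => //.
  by move=> a0; apply: continuous_oppf; exact: cf.
move=> x x0 xab; have [d dx d0] := df x x0 xab.
by exists (- d); [exact: is_derive_oppf|rewrite oppr_ge0].
Qed.
End calculus.
Arguments is_derive_cstf {R}.
Arguments is_derive_idf {R}.
Arguments continuous_cstf {R}.
Arguments continuous_idf {R}.

Ltac der_step := first
  [ notypeclasses refine (is_derive_cstf _ _)
  | notypeclasses refine (is_derive_idf _)
  | eassumption
  | notypeclasses refine (is_derive_sqrf _)
  | notypeclasses refine (is_derive_oppf _)
  | notypeclasses refine (is_derive_addf _ _)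
  | notypeclasses refine (is_derive_mulf _ _)
  | notypeclasses refine (is_derive_expRf _)
  | notypeclasses refine (is_derive_invf _ _) ].

Ltac der := notypeclasses refine (is_derive_eq _ _); [repeat der_step|rewrite /=].

Ltac cnt := rewrite /prop_for; lazymatch goal with
  | |- continuous_at _ (fun _ => ?a) => exact: continuous_cstf
  | |- continuous_at _ (fun t => t) => exact: continuous_idf
  | |- continuous_at _ (fun t => @?f t + @?g t) => apply: (@continuous_addf _ f g); cnt
  | |- continuous_at _ (fun t => @?f t * @?g t) => apply: (@continuous_mulf _ f g); cnt
  | |- continuous_at _ (fun t => - @?f t) => apply: (@continuous_oppf _ f); cnt
  | |- continuous_at _ (fun t => @?f t ^+ 2) => apply: (@continuous_sqrf _ f); cnt
  | |- continuous_at _ (fun t => expR (@?f t)) => apply: (@continuous_expRf _ f); cnt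
  | _ => eassumption
  end.

(** * Critical growth and the flux form of the radial equation *)

(** A bound for [f u / u] on [0 < u <= M]; [M + 1] rather than [M] because
    [u^beta] exceeds [u] below [1]. *)
Definition slope_bound (R : realType) (c M : R) : R :=
  expR (M ^+ 2 + c * (M + 1)).

(** Growth of [u * exp (u^2 + lower order)].  That the derivative of [log f] is
    [2 u + O(1)] and that the lower order term in [critical_le] is linear
    reflects an exponent [|u|^beta] with [beta <= 1]. *)
Record critical_growth (R : realType) (c : R) (f : R -> R) : Prop := Critical {
  critical_ge0 : 0 <= c;
  critical_gt0 : forall u : R, 0 < u -> 0 < f u;
  critical_odd : forall u : R, f (- u) = - f u;
  critical_log_derive : forall u : R, 1 <= u ->
    exists2 h : R, 2 * u <= h <= 2 * u + c & is_derive u 1 f (h * f u);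
  critical_le : forall u : R, 1 <= u -> f u <= expR (u ^+ 2 + c * u);
  critical_linear : forall M u : R, 0 < u <= M ->
    f u <= slope_bound c M * u }.

(** [g] is the solution along a radius and [P = - r g'] its flux; both are
    continued continuously to the origin. *)
Record flow (R : realType) (f : R -> R) (lam : R) (g P : R -> R) : Prop := Flow {
  flow_lam : 0 < lam;
  flow_P0 : P 0 = 0;
  flow_cont_g : {for 0, continuous g};
  flow_cont_P : {for 0, continuous P};
  flow_g : forall r : R, 0 < r < 1 -> is_derive r 1 g (- (P r / r));
  flow_P : forall r : R, 0 < r < 1 -> is_derive r 1 P (lam * r * f (g r)) }.

Lemma critical_at0 (R : realType) (c : R) (f : R -> R) : critical_growth c f -> f 0 = 0.
Proof.
move=> fc; have := critical_odd fc 0; rewrite oppr0 => /eqP.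
by rewrite -addr_eq0 -mulr2n mulrn_eq0 /= => /eqP.
Qed.

Section first_bubble.
Variables (R : realType) (c : R) (f : R -> R) (lam : R) (g P : R -> R) (r1 : R).
Hypothesis fc : critical_growth c f.
Hypothesis fl : flow f lam g P.
Hypothesis r1_itv : 0 < r1 < 1.
Hypothesis g_gt0 : forall r : R, 0 <= r < r1 -> 0 < g r.
Hypothesis g_r1 : g r1 = 0.

Implicit Types r a b v x : R.

Let c0 : 0 <= c. Proof. exact: critical_ge0 fc. Qed.
Let lam0 : 0 < lam. Proof. exact: flow_lam fl. Qed.
Let P0 : P 0 = 0. Proof. exact: flow_P0 fl. Qed.

(* [lra] reads the goal and the local context but not the section
   hypotheses, which are therefore pushed into the goal. *)
Local Ltac lin := have := r1_itv; have := c0; have := lam0; lra.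

Lemma g_ge0 r : 0 <= r <= r1 -> 0 <= g r.
Proof.
move=> /andP[r0]; rewrite le_eqVlt => /predU1P[->|rr1]; first by rewrite g_r1.
by apply/ltW/g_gt0; rewrite r0.
Qed.

Lemma f_g_ge0 r : 0 <= r <= r1 -> 0 <= f (g r).
Proof.
move=> /g_ge0; rewrite le_eqVlt => /predU1P[<-|]; first by rewrite (critical_at0 fc).
by move=> /(critical_gt0 fc)/ltW.
Qed.

Lemma flow_continuous_g r : 0 <= r < 1 -> {for r, continuous g}.
Proof.
move=> /andP[]; rewrite le_eqVlt => /predU1P[<- _|r0 rl].
  exact: flow_cont_g fl.
by apply: is_derive_continuous (flow_g fl _); rewrite r0.
Qed.

Lemma flow_continuous_P r : 0 <= r < 1 -> {for r, continuous P}.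
Proof.
move=> /andP[]; rewrite le_eqVlt => /predU1P[<- _|r0 rl].
  exact: flow_cont_P fl.
by apply: is_derive_continuous (flow_P fl _); rewrite r0.
Qed.

Lemma flux_nondecreasing a b : 0 <= a <= b -> b <= r1 -> P a <= P b.
Proof.
move=> ab br1; apply: nondecreasing_from => // [_|x x0 xab].
  exact: flow_cont_P fl.
exists (lam * x * f (g x)); first by apply: (flow_P fl); lin.
by rewrite !mulr_ge0 ?(ltW lam0) ?(ltW x0) ?f_g_ge0//; lin.
Qed.

Lemma flux_ge0 r : 0 <= r <= r1 -> 0 <= P r.
Proof. by move=> rr; have := @flux_nondecreasing 0 r; rewrite P0; apply; lin. Qed.

Lemma flux_gt0 r : 0 < r <= r1 -> 0 < P r.
Proof.
move=> rr; have r0 : 0 < r by lin.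
have dP x : x \in `]0, r[ -> is_derive x 1 P (lam * x * f (g x)).
  by rewrite in_itv /= => xr; apply: (flow_P fl); lin.
have cP : {within `[0, r], continuous P}.
  by apply: within_itv_continuous => x xr; apply: flow_continuous_P; lin.
have [x] := MVT r0 dP cP; rewrite in_itv /= P0 !subr0 => xr ->.
rewrite !mulr_gt0//; first by lin.
by apply: (critical_gt0 fc); apply: g_gt0; lin.
Qed.

Lemma profile_nonincreasing a b : 0 <= a <= b -> b <= r1 -> g b <= g a.
Proof.
move=> ab br1; apply: nonincreasing_from => // [_|x x0 xab].
  exact: flow_cont_g fl.
exists (- (P x / x)); first by apply: (flow_g fl); lin.
by rewrite oppr_le0 divr_ge0// ?(ltW x0)// flux_ge0//; lin.
Qed.

Lemma profile_attains v : 0 <= v <= g 0 -> exists2 r : R, 0 <= r <= r1 & g r = v.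
Proof.
move=> vg; have cg : {within `[0, r1], continuous g}.
  by apply: within_itv_continuous => x xr; apply: flow_continuous_g; lin.
have [||r] := @IVT R g 0 r1 v _ cg.
- by lin.
- by rewrite g_r1 minEle maxEle; case: ifP; lin.
by rewrite in_itv /= => rr <-; exists r.
Qed.

(** In the variable [log r] this is the derivative of the flux. *)
Definition source r := lam * r ^+ 2 * f (g r).
Local Notation p := source.

Lemma source_ge0 r : 0 <= r <= r1 -> 0 <= p r.
Proof.
by move=> /f_g_ge0 ?; rewrite /source mulr_ge0// mulr_ge0 ?sqr_ge0// ltW.
Qed.

Lemma source0 : p 0 = 0.
Proof. by rewrite /source expr0n /= mulr0 mul0r. Qed.

Lemma flow_P_source r : 0 < r < 1 -> is_derive r 1 P (p r / r).
Proof.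
move=> rr; apply: is_derive_eq (flow_P fl rr) _.
by rewrite /p; field; lin.
Qed.

Lemma source_derive r : 0 < r < 1 -> 1 <= g r -> exists2 h : R,
  2 * g r <= h <= 2 * g r + c & is_derive r 1 p (p r * (2 - h * P r) / r).
Proof.
move=> rr g1; have [h hb df] := critical_log_derive fc g1.
exists h => //; rewrite /source.
have dg := flow_g fl rr; have dfg := is_derive_compf df dg.
by der; field; lin.
Qed.

Lemma source_cont0 : 1 <= g 0 -> {for 0, continuous p}.
Proof.
move=> g1; have [h _ df] := critical_log_derive fc g1.
have cfg : {for 0, continuous (fun r => f (g r))}.
  by apply: continuous_comp (flow_cont_g fl) (is_derive_continuous df).
by rewrite /source; cnt.
Qed.

Local Notation mu := (g 0).
Local Notation H := (2 * mu + c).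

Lemma profile_le_top r : 0 <= r <= r1 -> g r <= mu.
Proof. by move=> rr; apply: profile_nonincreasing; lin. Qed.

Lemma profile_ge_from a r : 0 <= r <= r1 -> a <= g r ->
  forall x, 0 <= x <= r -> a <= g x.
Proof. by move=> rr ar x xr; apply: le_trans ar (profile_nonincreasing _ _); lin. Qed.

(** A Pohozaev inequality.  Replacing [h] by its lower bound [2 g] in
    [r p' = p (2 - h P)] turns [p - 2 P + g P^2] into a nonincreasing function,
    which vanishes at the origin; the leftover [- P^3] comes from
    differentiating the factor [g]. *)
Lemma pohozaev_upper r : 0 <= r <= r1 -> 1 <= g r ->
  p r + g r * P r ^+ 2 <= 2 * P r.
Proof.
move=> rr gr; have g1 := profile_ge_from rr gr.
suff: p r - 2 * P r + g r * P r ^+ 2 <= p 0 - 2 * P 0 + g 0 * P 0 ^+ 2.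
  by rewrite source0 P0; lin.
apply: (@nonincreasing_from _ (fun t => p t - 2 * P t + g t * P t ^+ 2)).
- by lin.
- move=> _; have g10 : 1 <= mu by apply: g1; lin.
  have cp := source_cont0 g10; have cg := flow_cont_g fl.
  by have cP := flow_cont_P fl; cnt.
move=> x x0 xr; have x1 : 0 < x < 1 by lin.
have [|h hb dp] := source_derive x1 _; first by apply: g1.
have dg := flow_g fl x1; have dP := flow_P_source x1.
exists ((p x * P x * (2 * g x - h) - P x ^+ 3) / x).
  by der; field; lin.
have Px : 0 <= P x by apply: flux_ge0; lin.
have px : 0 <= p x by apply: source_ge0; lin.
rewrite ler_pdivrMr// mul0r subr_le0 (@le_trans _ _ 0)// ?exprn_ge0//.
by rewrite mulr_ge0_le0 ?(mulr_ge0 px Px)//; lin.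
Qed.

(** The companion of [pohozaev_upper]: now [h] is replaced by its largest value
    [H].  The inequality says that, in [log r], the flux grows at least as fast
    as the logistic function that describes a Liouville bubble. *)
Lemma pohozaev_lower r : 0 <= r <= r1 -> 1 <= g r ->
  2 * P r - H / 2 * P r ^+ 2 <= p r.
Proof.
move=> rr gr; have g1 := profile_ge_from rr gr.
suff: p 0 - 2 * P 0 + H / 2 * P 0 ^+ 2 <= p r - 2 * P r + H / 2 * P r ^+ 2.
  by rewrite source0 P0; lin.
apply: (@nondecreasing_from _ (fun t => p t - 2 * P t + H / 2 * P t ^+ 2)).
- by lin.
- move=> _; have g10 : 1 <= mu by apply: g1; lin.
  by have cp := source_cont0 g10; have cP := flow_cont_P fl; cnt.
move=> x x0 xr; have x1 : 0 < x < 1 by lin.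
have [|h hb dp] := source_derive x1 _; first by apply: g1.
have dP := flow_P_source x1.
exists (p x * P x * (H - h) / x).
  by der; field; lin.
have Px : 0 <= P x by apply: flux_ge0; lin.
have px : 0 <= p x by apply: source_ge0; lin.
have gx : g x <= mu by apply: profile_le_top; lin.
by rewrite mulr_ge0 ?invr_ge0 ?(ltW x0)// mulr_ge0 ?(mulr_ge0 px Px)//; lin.
Qed.

(** As a function of [g], the logistic inequality is linear: the gap
    [4 / H - P] to the terminal flux decays at rate at least [H / 2] when [g]
    decreases. *)
Lemma flux_gap r : 0 <= r <= r1 -> 1 <= g r ->
  4 / H - P r <= 4 / H * expR (- (H / 2 * (mu - g r))).
Proof.
move=> rr gr; have g1 := profile_ge_from rr gr.
have g10 : 1 <= mu by apply: g1; lin.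
have H0 : 0 < H by lin.
rewrite mulrBr opprB expRD mulrA expRN ler_pdivlMr ?expR_gt0//.
suff: (4 / H - P r) * expR (- (H / 2 * g r)) <=
      (4 / H - P 0) * expR (- (H / 2 * g 0)).
  rewrite P0 subr0 !expRN => E.
  have e1 := expR_gt0 (H / 2 * g r); have e2 := expR_gt0 (H / 2 * g 0).
  move: E; rewrite ler_pdivrMr// mulrAC ler_pdivlMr//.
apply: (@nonincreasing_from _ (fun t => (4 / H - P t) * expR (- (H / 2 * g t)))).
- by lin.
- by move=> _; have cg := flow_cont_g fl; have cP := flow_cont_P fl; cnt.
move=> x x0 xr; have x1 : 0 < x < 1 by lin.
have dg := flow_g fl x1; have dP := flow_P_source x1.
exists (expR (- (H / 2 * g x)) * ((2 * P x - H / 2 * P x ^+ 2) - p x) / x).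
  by der; field; lin.
rewrite ler_pdivrMr// mul0r mulr_ge0_le0 ?expR_ge0// subr_le0.
by apply: pohozaev_lower; [lin|exact: g1].
Qed.

(** * Behaviour past the first bubble *)

(* [C]: excess of [2 / P] over [mu] that is allowed past the bubble.
   [m]: the descent is followed down to this fixed height, two above [C] so
   that the source still decays at unit rate in [g] ([source_decay]).
   [K]: equal to [8 * (4 * C + 5)], which is what [flux_quadratic] requires
   for the conclusion [(mu - K) P <= 2] of [flux_upper]. *)
Local Notation C := (c / 2 + 2).
Local Notation m := (c / 2 + 4).
Local Notation K := (16 * c + 104).
Hypothesis mu_large : 2 * K <= mu.
Local Ltac lin' := have := mu_large; lin.

(** One unit below the top the gap of [flux_gap] is already negligible, since
    its exponent is at least [H / 2]; the crude bound [exp (- x) <= 1 / x]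
    suffices and gives [P >= 4 / H * (1 - 2 / H)]. *)
Lemma flux_past_bubble r : 0 <= r <= r1 -> 1 <= g r <= mu - 1 ->
  2 <= (mu + C) * P r.
Proof.
move=> rr gr; have H0 : 4 <= H by lin'.
have g1 : 1 <= g r by lra.
have gap := flux_gap rr g1.
have exp_le : expR (- (H / 2 * (mu - g r))) <= 2 / H.
  rewrite expRN -[2 / H]invf_div lef_pV2 ?posrE ?expR_gt0 ?divr_gt0//; last by lra.
  apply: le_trans (expR_ge1Dx _); rewrite (@le_trans _ _ (H / 2 * 1))//; first by lra.
  by apply: ler_wpDl => //; apply: ler_wpM2l; lra.
have kH : H * H^-1 = 1 by rewrite divff//; lra.
have k0 : 0 < H^-1 by rewrite invr_gt0; lra.
have k4 : H^-1 <= 4^-1 by rewrite lef_pV2 ?posrE; lra.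
have P_ge : 4 / H * (1 - 2 / H) <= P r.
  have : 4 / H * expR (- (H / 2 * (mu - g r))) <= 4 / H * (2 / H).
    by apply: ler_wpM2l => //; lra.
  by lra.
have -> : mu + C = H / 2 + 2 by field.
apply: le_trans (ler_wpM2l _ P_ge); last by lra.
have -> : (H / 2 + 2) * (4 / H * (1 - 2 / H)) =
  2 * (H * H^-1) + 8 * H^-1 - 4 * (H * H^-1) * H^-1 - 16 * H^-1 * H^-1 by field; lra.
by rewrite kH; nra.
Qed.

Lemma flux_scale r : 0 <= r <= r1 -> 1 <= g r <= mu - 1 -> 1 <= mu * P r.
Proof.
move=> rr gr; have := flux_past_bubble rr gr; have P0' := flux_ge0 rr.
have : C * P r <= mu * P r by apply: ler_wpM2r => //; lin'.
by lra.
Qed.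

(** [r0], where the solution is one unit below its top, marks the edge of the
    bubble. *)
Section past_bubble.
Variable r0 : R.
Hypothesis r0_itv : 0 <= r0 <= r1.
Hypothesis g_r0 : g r0 = mu - 1.
Local Ltac lin0 := have := r0_itv; have := g_r0; lin'.

Lemma edge_flux_le : mu * P r0 <= 4.
Proof.
have gr : 1 <= g r0 by lin0.
have := pohozaev_upper r0_itv gr; have := source_ge0 r0_itv.
rewrite g_r0; have := flux_ge0 r0_itv.
rewrite le_eqVlt => /predU1P[<-|P_gt0]; first by rewrite mulr0; lra.
move=> p_ge0 poh.
have : (mu - 1) * P r0 <= 2.
  by rewrite -(ler_pM2r P_gt0) -mulrA -expr2; lra.
have : (mu / 2) * P r0 <= (mu - 1) * P r0 by apply: ler_wpM2r; [exact: ltW|lin0].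
by lra.
Qed.

(** The upper and lower bounds for the flux at the edge differ by [O(1)] in
    [2 / P]; inserted in [pohozaev_upper] they show that the source at the edge
    is of the order [P^2], smaller by a factor [1 / mu] than inside the bubble. *)
Lemma edge_source_le : p r0 <= (C + 1) * P r0 ^+ 2.
Proof.
have gr : 1 <= g r0 by lin0.
have := pohozaev_upper r0_itv gr; rewrite g_r0.
have P_ge0 := flux_ge0 r0_itv.
have : 2 <= (mu + C) * P r0 by apply: flux_past_bubble => //; lin0.
by move=> /(ler_wpM2r P_ge0); lra.
Qed.

(** Past the edge [2 <= (mu + C) P], so [lam r^2 exp ((mu + C) g)] decreases.
    Compared with [p], whose dependence on [g] is at least that of
    [exp (g^2)], this leaves the factor
    [exp ((g r0 - g) (1 + C - g))], and [1 + C - g <= - 1] above height [m]. *)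
Lemma source_decay r : r0 <= r <= r1 -> m <= g r ->
  p r <= p r0 * expR (g r - (mu - 1)).
Proof.
move=> rr gr.
have gm x : 0 <= x <= r -> m <= g x by apply: profile_ge_from => //; lin0.
have g_le x : r0 <= x <= r -> g x <= mu - 1.
  by move=> xr; rewrite -g_r0; apply: profile_nonincreasing; lin0.
have mono : p r * expR ((mu + C) * g r - g r ^+ 2) <=
            p r0 * expR ((mu + C) * g r0 - g r0 ^+ 2).
  apply: (@nonincreasing_from _
    (fun t => p t * expR ((mu + C) * g t - g t ^+ 2))); first by lin0.
    move=> r00; have cp : {for 0, continuous p}.
      by apply: source_cont0; have := gm 0; lin0.
    by have cg := flow_cont_g fl; cnt.
  move=> x x0 xr; have x1 : 0 < x < 1 by lin0.
  have gx : m <= g x by apply: gm; lin0.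
  have gx' : g x <= mu - 1 by apply: g_le.
  have gx1 : 1 <= g x by lin0.
  have [h hb dp] := source_derive x1 gx1.
  have dg := flow_g fl x1.
  exists (p x * expR ((mu + C) * g x - g x ^+ 2) *
     (2 - (mu + C) * P x - (h - 2 * g x) * P x) / x).
    by der; field; lra.
  have px : 0 <= p x by apply: source_ge0; lin0.
  have Px : 0 <= P x by apply: flux_ge0; lin0.
  rewrite ler_pdivrMr// mul0r mulr_ge0_le0 ?(mulr_ge0 px (expR_ge0 _))//.
  have : 2 <= (mu + C) * P x by apply: flux_past_bubble; lin0.
  have : 0 <= (h - 2 * g x) * P x by apply: mulr_ge0 => //; lra.
  by lra.
move: mono; rewrite -ler_pdivlMr ?expR_gt0// => /le_trans; apply.
rewrite -mulrA -expRN -expRD ler_wpM2l ?source_ge0 ?ler_expR//.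
have : 0 <= (g r0 - g r) * (g r - C - 2).
  by apply: mulr_ge0; rewrite ?g_r0 ?subr_ge0 ?g_le//; lin0.
rewrite g_r0; lra.
Qed.

(** [p - 2 P + mu P^2] would be nonincreasing if [h] were at least [2 mu].  The
    defect is [2 (mu - g) P p], and by [source_decay] it is compensated by
    the derivative of an explicit primitive of
    [(mu - g) exp (g - (mu - 1))] in [g]. *)
Lemma flux_quadratic r : r0 <= r <= r1 -> m <= g r ->
  mu * P r ^+ 2 - 2 * P r <= (4 * C + 5) * P r0 ^+ 2.
Proof.
move=> rr gr.
have gm x : 0 <= x <= r -> m <= g x by apply: profile_ge_from => //; lin0.
have g_le x : r0 <= x <= r -> g x <= mu - 1.
  by move=> xr; rewrite -g_r0; apply: profile_nonincreasing; lin0.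
pose W t := p r0 * ((mu - g t + 1) * expR (g t - (mu - 1))).
have mono : p r - 2 * P r + mu * P r ^+ 2 + 2 * W r <=
            p r0 - 2 * P r0 + mu * P r0 ^+ 2 + 2 * W r0.
  apply: (@nonincreasing_from _
    (fun t => p t - 2 * P t + mu * P t ^+ 2 + 2 * W t)); first by lin0.
    move=> r00; have cp : {for 0, continuous p}.
      by apply: source_cont0; have := gm 0; lin0.
    by have cg := flow_cont_g fl; have cP := flow_cont_P fl; rewrite /W; cnt.
  move=> x x0 xr; have x1 : 0 < x < 1 by lin0.
  have gx : m <= g x by apply: gm; lin0.
  have gx' : g x <= mu - 1 by apply: g_le.
  have gx1 : 1 <= g x by lin0.
  have [h hb dp] := source_derive x1 gx1.
  have dg := flow_g fl x1; have dP := flow_P_source x1.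
  exists (P x * (p x * (2 * mu - h) -
     2 * (mu - g x) * (p r0 * expR (g x - (mu - 1)))) / x).
    by rewrite /W; der; field; lra.
  have px : 0 <= p x by apply: source_ge0; lin0.
  have Px : 0 <= P x by apply: flux_ge0; lin0.
  rewrite ler_pdivrMr// mul0r mulr_ge0_le0// subr_le0.
  apply: (@le_trans _ _ (2 * (mu - g x) * p x)).
    by rewrite mulrC; apply: ler_wpM2r => //; lra.
  by apply: ler_wpM2l; [lra|apply: source_decay; lin0].
have W_ge0 : 0 <= W r.
  apply: mulr_ge0; first exact: source_ge0.
  apply: mulr_ge0 (expR_ge0 _).
  by have := g_le r; lin0.
have W0 : W r0 = p r0 * 2.
  by rewrite /W g_r0 subrr expR0 mulr1; congr (_ * _); ring.
have gr0 : 1 <= g r0 by lin0.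
have := pohozaev_upper r0_itv gr0; have := edge_source_le.
have : 0 <= p r by apply: source_ge0; lin0.
by move: mono; rewrite W0 g_r0; lra.
Qed.

End past_bubble.

Lemma edge_exists : exists2 r0 : R, 0 <= r0 <= r1 & g r0 = mu - 1.
Proof. by apply: profile_attains; lin'. Qed.

(** After multiplication by [mu^2], [flux_quadratic] reads
    [(mu P) (mu (mu P - 2)) <= 2 K] because [mu P <= 4] at the edge; with
    [1 <= mu P] this is [mu P <= 2 + O(1 / mu)].  Inside the bubble
    [pohozaev_upper] gives [g P <= 2] directly. *)
Lemma flux_upper r : 0 <= r <= r1 -> m <= g r -> (mu - K) * P r <= 2.
Proof.
move=> rr gr; have [r0 r0_itv g_r0] := edge_exists.
have P_ge0 := flux_ge0 rr.
have [r_le|r_gt] := leP r r0.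
  have gr1 : mu - 1 <= g r by rewrite -g_r0; apply: profile_nonincreasing; lin'.
  have [->|r_n0] := eqVneq r 0; first by rewrite P0 mulr0.
  have P_gt0 : 0 < P r by apply: flux_gt0; rewrite lt_neqAle eq_sym r_n0; lra.
  have g1 : 1 <= g r by lin'.
  have := pohozaev_upper rr g1.
  have := source_ge0 rr => p_ge0 poh.
  have gP : g r * P r <= 2.
    by rewrite -(ler_pM2r P_gt0) -mulrA -expr2; lra.
  have : (mu - K) * P r <= g r * P r by apply: ler_wpM2r => //; lin'.
  by lra.
have quad : mu * P r ^+ 2 - 2 * P r <= (4 * C + 5) * P r0 ^+ 2.
  by apply: flux_quadratic => //; lra.
have scale : 1 <= mu * P r.
  apply: flux_scale => //; rewrite -g_r0.
  rewrite profile_nonincreasing ?andbT; lin'.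
have edge := edge_flux_le r0_itv g_r0.
have mu0 : 0 < mu by lin'.
have [|P_big] := leP (mu * P r) 2.
  have : 0 <= K * P r by apply: mulr_ge0 => //; lin'.
  by lra.
have edge2 : mu ^+ 2 * P r0 ^+ 2 <= 16.
  have : 0 <= mu * P r0 by apply: mulr_ge0; [exact: ltW|apply: flux_ge0].
  by rewrite -exprMn => ?; rewrite (_ : 16 = 4 ^+ 2) ?lerXn2r ?nnegrE//; ring.
have bound : (mu * P r) * (mu * (mu * P r - 2)) <= 2 * K.
  have -> : (mu * P r) * (mu * (mu * P r - 2)) =
    mu ^+ 2 * (mu * P r ^+ 2 - 2 * P r) by ring.
  apply: le_trans (ler_wpM2l (sqr_ge0 _) quad) _.
  have -> : mu ^+ 2 * ((4 * C + 5) * P r0 ^+ 2) =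
    (4 * C + 5) * (mu ^+ 2 * P r0 ^+ 2) by ring.
  apply: le_trans (_ : (4 * C + 5) * 16 <= _); last by lin'.
  by apply: ler_wpM2l edge2; lin'.
have mu_gap : mu * (mu * P r - 2) <= K * (mu * P r).
  have e0 : 0 <= mu * (mu * P r - 2) by apply: mulr_ge0; lra.
  have : 1 * (mu * (mu * P r - 2)) <= (mu * P r) * (mu * (mu * P r - 2)).
    exact: ler_wpM2r.
  have : K * 2 <= K * (mu * P r) by apply: ler_wpM2l; lin'.
  by lra.
rewrite -(ler_pM2l mu0); lra.
Qed.

(** * The first zero *)

(* [D] collects [c + K + m + 2], the coefficients of [mu] that the exponent
   loses in [eigenvalue_lower].  [fm] bounds [f] on the heights in [[0, m]]. *)
Local Notation D := (17 * c + c / 2 + 110).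
Local Notation fm := (slope_bound c m * m).

(** The middle of the bubble, where the logistic lower bound for the source is
    largest. *)
Lemma half_flux : exists2 s : R, 0 < s <= r1 & P s = 2 / H /\ mu - 1 <= g s.
Proof.
have [r0 rr g_r0] := edge_exists; have H0 : 4 <= H by lin'.
have cP : {within `[0, r0], continuous P}.
  by apply: within_itv_continuous => x xr; apply: flow_continuous_P; lin.
have P_big : 2 / H <= P r0.
  have : 2 <= (mu + C) * P r0 by apply: flux_past_bubble; lin'.
  have -> : mu + C = H / 2 + 2 by field.
  have : 0 <= (H / 2 - 2) * P r0 by apply: mulr_ge0; [lra|exact: flux_ge0].
  by rewrite ler_pdivrMr; lra.
have two0 : 0 < 2 / H by apply: divr_gt0; lra.
have r00 : 0 <= r0 by lra.
have [|s] := @IVT R P 0 r0 (2 / H) r00 cP.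
  by rewrite P0 minEle maxEle; case: ifP; lra.
rewrite in_itv /= => sr Ps; exists s.
  rewrite lt_neqAle; have [s0|] := eqVneq 0 s; last by lra.
  by move: two0; rewrite -Ps -s0 P0 ltxx.
by split=> //; rewrite -g_r0; apply: profile_nonincreasing; lin.
Qed.

(** By [flux_upper], [lam r^2 exp ((mu - K) g)] is nondecreasing down to height
    [m].  It starts in the middle of the bubble, where the source is at least
    [2 / H], so that [lam s^2] is at least [exp (- (g s)^2 - O(mu))] there.
    What remains of the quadratic terms is [g s * (mu - g s)], which has the
    good sign. *)
Lemma eigenvalue_lower : expR (- (D * mu)) <= lam * r1 ^+ 2.
Proof.
have [s sr [Ps gs]] := half_flux; have H0 : 4 <= H by lin'.
have [|rm rmr grm] := @profile_attains m; first by lin'.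
have sm : s <= rm.
  rewrite leNgt; apply/negP => ms.
  have : g s <= g rm by apply: profile_nonincreasing; lra.
  by lin'.
have g_m x : 0 <= x <= rm -> m <= g x.
  by apply: profile_ge_from => //; rewrite grm.
have grow : lam * s ^+ 2 * expR ((mu - K) * g s) <=
            lam * rm ^+ 2 * expR ((mu - K) * g rm).
  apply: (@nondecreasing_from _
    (fun t => lam * t ^+ 2 * expR ((mu - K) * g t))); [lra|lra|].
  move=> x x0 xr; have x1 : 0 < x < 1 by lin.
  have dg := flow_g fl x1.
  exists (lam * x * expR ((mu - K) * g x) * (2 - (mu - K) * P x)).
    by der; field; lra.
  rewrite mulr_ge0 ?mulr_ge0 ?expR_ge0 ?(ltW lam0) ?(ltW x0)// subr_ge0.
  by apply: flux_upper; [lin|apply: g_m; lin].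
have gs1 : 1 <= g s by lin'.
have gs_mu : g s <= mu by apply: profile_le_top; lra.
have start : expR (- (H / 2) - g s ^+ 2 - c * g s) <= lam * s ^+ 2.
  have fs := critical_le fc gs1.
  have fs0 : 0 < f (g s) by apply: (critical_gt0 fc); lra.
  rewrite -(ler_pM2r fs0) (_ : lam * _ * _ = p s)//.
  apply: (@le_trans _ _ (2 / H)); last first.
    have ps : 2 * P s - H / 2 * P s ^+ 2 <= p s by apply: pohozaev_lower; lra.
    by apply: le_trans ps; rewrite Ps le_eqVlt; apply/orP; left; apply/eqP; field; lra.
  apply: (@le_trans _ _ (expR (- (H / 2)))).
    rewrite -addrA -opprD expRD -mulrA -[leRHS]mulr1.
    apply: ler_wpM2l; first exact: expR_ge0.
    by rewrite expRN mulrC ler_pdivrMr ?expR_gt0// mul1r.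
  rewrite expRN -[2 / H]invf_div lef_pV2 ?posrE ?expR_gt0 ?divr_gt0//; last by lra.
  by apply: le_trans (expR_ge1Dx _); lra.
have end_ : lam * rm ^+ 2 <= lam * r1 ^+ 2.
  by apply: ler_wpM2l; [exact: ltW|rewrite lerXn2r ?nnegrE; lin].
apply: le_trans end_.
rewrite -(ler_pM2r (expR_gt0 ((mu - K) * g rm))).
apply: le_trans grow.
apply: le_trans (ler_wpM2r (expR_ge0 _) start).
rewrite -!expRD ler_expR grm.
have : 0 <= g s * (mu - g s) by apply: mulr_ge0; lra.
have : 0 <= (c + K) * (mu - g s) by apply: mulr_ge0; lin'.
have : 0 <= K * m by apply: mulr_ge0; lin'.
by lin'.
Qed.

(** Below height [m] the source is at most [lam r^2 fm], whose integral against
    [dr / r] is [lam r1^2 fm / 2]. *)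
Lemma exit_flux : P r1 <= 4 / mu + fm / 2 * (lam * r1 ^+ 2).
Proof.
have mu0 : 0 < mu by lin'.
have [|rm rmr grm] := @profile_attains m; first by lin'.
have P_rm : P rm <= 4 / mu.
  rewrite ler_pdivlMr//.
  have : (mu - K) * P rm <= 2 by apply: flux_upper; rewrite ?grm.
  have : mu / 2 * P rm <= (mu - K) * P rm.
    by apply: ler_wpM2r; [exact: flux_ge0|lin'].
  by lra.
have fm0 : 0 <= fm by apply: mulr_ge0; [exact: expR_ge0|lin'].
have : P r1 - fm / 2 * (lam * r1 ^+ 2) <= P rm - fm / 2 * (lam * rm ^+ 2).
  apply: (@nonincreasing_from _ (fun t => P t - fm / 2 * (lam * t ^+ 2))).
  - by lra.
  - by move=> _; have cP := flow_cont_P fl; cnt.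
  move=> x x0 xr; have x1 : 0 < x < 1 by lin.
  have dP := flow_P fl x1.
  exists (lam * x * (f (g x) - fm)).
    by der; field; lra.
  rewrite mulr_ge0_le0 ?mulr_ge0 ?(ltW lam0) ?(ltW x0)// subr_le0.
  have gx : 0 <= g x by apply: g_ge0; lra.
  have gx' : g x <= m by rewrite -grm; apply: profile_nonincreasing; lra.
  have [g0|g_n0] := eqVneq (g x) 0; first by rewrite g0 (critical_at0 fc).
  have gxm : 0 < g x <= m by rewrite lt_neqAle eq_sym g_n0 gx.
  apply: le_trans (critical_linear fc gxm) _.
  by apply: ler_wpM2l; [exact: expR_ge0|].
have : 0 <= fm / 2 * (lam * rm ^+ 2).
  by apply: mulr_ge0; [lra|apply: mulr_ge0; [exact: ltW|exact: sqr_ge0]].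
by lra.
Qed.

(** With [L = lam r1^2] one has [log (1 / r1) <= log (1 / L) / 2], and
    [exit_flux] bounds the product by multiples of [log (1 / L) / mu] and
    [L log (1 / L)].  The first is controlled by [eigenvalue_lower], the second
    by [log x <= x]. *)
Lemma exit_flux_log : lam <= 1 -> P r1 * - ln r1 <= 2 * D + fm / 4.
Proof.
move=> lam1; have mu0 : 0 < mu by lin'.
have r10 : 0 < r1 by lin.
set L := lam * r1 ^+ 2.
have L0 : 0 < L by rewrite mulr_gt0 ?exprn_gt0.
have lnL : - ln L <= D * mu.
  by rewrite lerNl -[leLHS]expRK ler_ln ?posrE ?expR_gt0// eigenvalue_lower.
have lnL' : L * - ln L <= 1.
  have : - ln L <= L^-1 by rewrite -lnV ?posrE// ltW// ln_sublinear// invr_gt0.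
  by move=> /(ler_wpM2l (ltW L0)); rewrite divff// gt_eqF.
have ln_r1 : - ln r1 <= - ln L / 2.
  have -> : ln L = ln lam + 2 * ln r1.
    by rewrite /L lnM ?posrE ?exprn_gt0// lnXn// mulr_natl.
  by have := ln_le0 lam1; lra.
have lr0 : 0 <= - ln r1 by rewrite oppr_ge0 ln_le0//; lin.
have fm0 : 0 <= fm by apply: mulr_ge0; [exact: expR_ge0|lin'].
have E0 : 0 <= 4 / mu + fm / 2 * L.
  apply: addr_ge0; apply: mulr_ge0; rewrite ?invr_ge0 ?(ltW L0) ?(ltW mu0)//.
  by lra.
apply: le_trans (ler_wpM2r lr0 exit_flux) _; rewrite -/L.
apply: le_trans (ler_wpM2l E0 ln_r1) _.
have -> : (4 / mu + fm / 2 * L) * (- ln L / 2) =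
  2 * (- ln L / mu) + fm / 4 * (L * - ln L) by field; lra.
apply: lerD; first by apply: ler_wpM2l => //; rewrite ler_pdivrMr.
by rewrite -[leRHS]mulr1; apply: ler_wpM2l => //; lra.
Qed.

End first_bubble.

(** * Weakly loaded nodal intervals *)

(** [phi = 2 - e r^2] with [e = lam L / 2] is a positive supersolution of the
    linearized equation [(r v')' + lam r L v = 0].  The Wronskian of [w] and
    [phi] is then nondecreasing, so it stays nonnegative, and [w / phi] cannot
    decrease.  Only continuity of [w] is asked at [b], which may be the boundary
    of the disk. *)
Lemma weak_load_end_gt0 (R : realType) (lam L a b : R) (w Q F : R -> R) :
  0 <= a < b -> b <= 1 -> 0 <= lam -> 0 <= L -> lam * L <= 2 ->
  {within `[a, b], continuous w} -> 0 <= Q a ->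
  (a = 0 -> {for 0, continuous w} /\ {for 0, continuous Q}) ->
  (forall t : R, 0 < t -> a <= t < b -> is_derive t 1 w (Q t / t)) ->
  (forall t : R, 0 < t -> a <= t < b -> is_derive t 1 Q (- (lam * t * F t))) ->
  (forall t : R, a <= t < b -> 0 <= w t) ->
  (forall t : R, a < t < b -> 0 < w t) ->
  (forall t : R, a <= t < b -> F t <= L * w t) ->
  0 < w b.
Proof.
move=> ab b1 lam0 L0 lamL cw Qa c0 dw dQ w_ge0 w_gt0 FL.
pose e := lam * L / 2; pose phi (t : R) : R := 2 - e * t ^+ 2.
have lamL0 : 0 <= lam * L by exact: mulr_ge0.
have e01 : 0 <= e <= 1 by rewrite /e; lra.
have et (t : R) : 0 <= t <= 1 -> 0 <= e * t ^+ 2 <= 1.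
  move=> t01; apply/andP; split; first by apply: mulr_ge0; [lra|exact: sqr_ge0].
  rewrite -[leRHS]mulr1; apply: ler_pM; rewrite ?sqr_ge0//; [lra|lra|].
  by rewrite expr_le1 ?(proj1 (andP t01)) ?(proj2 (andP t01)).
have phi12 (t : R) : 0 <= t <= 1 -> 1 <= phi t <= 2 by move=> /et; rewrite /phi; lra.
have dphi (t : R) : is_derive t 1 phi (- (e * (2 * t))).
  by rewrite /phi; der; ring.
pose V (t : R) : R := Q t * phi t + 2 * e * (t ^+ 2 * w t).
have V_ge0 (x : R) : a <= x < b -> 0 <= V x.
  move=> xab; have Va : 0 <= V a.
    have wa : 0 <= w a by apply: w_ge0; lra.
    have pa : 1 <= phi a <= 2 by apply: phi12; lra.
    apply: addr_ge0; first by apply: mulr_ge0; lra.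
    by apply: mulr_ge0; [lra|apply: mulr_ge0 => //; exact: sqr_ge0].
  apply: (le_trans Va); apply: nondecreasing_from; first by lra.
    by move=> /c0[cw0 cQ0]; rewrite /V /phi; cnt.
  move=> t t0 tx; have tab : a <= t < b by lra.
  have dwt := dw t t0 tab; have dQt := dQ t t0 tab.
  exists (lam * t * (2 * L * w t - F t * phi t)).
    by rewrite /V /phi /e; der; field; lra.
  have pt : 1 <= phi t <= 2 by apply: phi12; lra.
  rewrite mulr_ge0 ?mulr_ge0 ?(ltW t0)// subr_ge0.
  apply: (@le_trans _ _ (L * w t * phi t)).
    by apply: ler_wpM2r; [lra|exact: FL].
  have : 0 <= L * w t by apply: mulr_ge0 => //; apply: w_ge0.
  by move=> Lw; have := ler_wpM2l Lw (proj2 (andP pt)); lra.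
have [x xab] : exists x : R, a < x < b by exists ((a + b) / 2); lra.
have pb : 1 <= phi b <= 2 by apply: phi12; lra.
have px : 1 <= phi x <= 2 by apply: phi12; lra.
have mono : w x * (phi x)^-1 <= w b * (phi b)^-1.
  apply: (@nondecreasing_within _ (fun t => w t * (phi t)^-1)); first by lra.
    have cphi : {within `[x, b], continuous (fun t => (phi t)^-1)}.
      apply: within_itv_continuous => t tab.
      have pt : 1 <= phi t <= 2 by apply: phi12; lra.
      have pt0 : phi t != 0 by rewrite gt_eqF; lra.
      exact: is_derive_continuous (is_derive_invf pt0 (dphi t)).
    have cwx : {within `[x, b], continuous w}.
      apply: continuous_subspaceW cw => t /=.
      by rewrite !in_itv /=; lra.
    by move=> t; apply: cvgM; [exact: cwx|exact: cphi].
  move=> t tab; have t0 : 0 < t by lra.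
  have tab' : a <= t < b by lra.
  have dwt := dw t t0 tab'.
  have pt : 1 <= phi t <= 2 by apply: phi12; lra.
  have pt0 : phi t != 0 by rewrite gt_eqF; lra.
  exists (V t / (t * phi t ^+ 2)).
    by have dphit := dphi t; der; rewrite /V; field; rewrite pt0; lra.
  by apply: divr_ge0; [exact: V_ge0|apply: mulr_ge0; [exact: ltW|exact: sqr_ge0]].
have : 0 < w x * (phi x)^-1.
  by apply: mulr_gt0; [exact: w_gt0|rewrite invr_gt0; lra].
move=> /lt_le_trans/(_ mono); rewrite pmulr_lgt0// invr_gt0; lra.
Qed.

(** * The second nodal interval *)

(** The sum of the height above which the bubble estimates apply and of the
    bound that [exit_flux_log] gives for the second nodal interval, so that a
    single smallness condition on [lam] serves on both intervals. *)
Definition amplitude_bound (R : realType) (c : R) : R :=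
  2 * (16 * c + 104) + 2 * (17 * c + c / 2 + 110) +
  slope_bound c (c / 2 + 4) * (c / 2 + 4) / 4.

Section nodal_flow.
Variables (R : realType) (c : R) (f : R -> R) (lam : R) (g P : R -> R) (r1 : R).
Hypothesis fc : critical_growth c f.
Hypothesis fl : flow f lam g P.
Hypothesis r1_itv : 0 < r1 < 1.
Hypothesis g_gt0 : forall r : R, 0 <= r < r1 -> 0 < g r.
Hypothesis g_r1 : g r1 = 0.
Local Notation M := (amplitude_bound c).
Hypothesis lam_small : lam * slope_bound c M <= 2.
Hypothesis lam_le1 : lam <= 1.

Lemma first_bump_high : 2 * (16 * c + 104) <= g 0.
Proof.
rewrite leNgt; apply/negP => g_small.
have c0 := critical_ge0 fc; have lam0 := flow_lam fl; have r11 := r1_itv.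
have e0 : 0 <= slope_bound c (c / 2 + 4) by exact: expR_ge0.
have gM t : 0 <= t < r1 -> 0 < g t <= M.
  move=> tr; rewrite g_gt0//=; apply: (@le_trans _ _ (g 0)).
    by apply: (profile_nonincreasing fc fl r1_itv g_gt0 g_r1); lra.
  have : 0 <= slope_bound c (c / 2 + 4) * (c / 2 + 4).
    by apply: mulr_ge0 => //; lra.
  by rewrite /amplitude_bound; lra.
suff: 0 < g r1 by rewrite g_r1 ltxx.
apply: (@weak_load_end_gt0 _ lam (slope_bound c M) 0 r1 g (fun t => - P t)
  (fun t => f (g t))) => //.
- by lra.
- by lra.
- exact: ltW.
- exact: expR_ge0.
- apply: within_itv_continuous => t tr.
  by apply: (flow_continuous_g fl); lra.
- by rewrite (flow_P0 fl) oppr0.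
- move=> _; split; first exact: flow_cont_g fl.
  by apply: continuous_oppf; exact: flow_cont_P fl.
- move=> t t0 tr; have t1 : 0 < t < 1 by lra.
  by have dg := flow_g fl t1; der; field; lra.
- move=> t t0 tr; have t1 : 0 < t < 1 by lra.
  exact/is_derive_oppf/(flow_P fl).
- by move=> t /gM/andP[/ltW].
- by move=> t tr; apply: g_gt0; lra.
- by move=> t /gM/(critical_linear fc).
Qed.

(** On this interval the flux decreases from [P r1], so [g + P r1 * log r]
    is nondecreasing; this bounds [- g] by [P r1 * log (1 / r1)], and
    [weak_load_end_gt0] applies to [- g], whose flux is [- P]. *)
Lemma second_bump_persists r2 : r1 < r2 <= 1 ->
  {within `[r1, r2], continuous g} ->
  (forall r : R, r1 < r < r2 -> g r < 0) -> g r2 < 0.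
Proof.
move=> r12 cg g_lt0.
have c0 := critical_ge0 fc; have lam0 := flow_lam fl; have r11 := r1_itv.
have r10 : 0 < r1 by lra.
have P_r1 : 0 < P r1 by apply: (flux_gt0 fc fl r1_itv g_gt0); lra.
have g_le0 t : r1 <= t < r2 -> g t <= 0.
  move=> tr; have [<-|n] := eqVneq r1 t; first by rewrite g_r1.
  by apply/ltW/g_lt0; rewrite lt_neqAle n.
have P_le t : r1 <= t < r2 -> P t <= P r1.
  move=> tr; apply: nonincreasing_from; [lra|lra|].
  move=> x x0 xr; exists (lam * x * f (g x)); first by apply: (flow_P fl); lra.
  rewrite mulr_ge0_le0 ?mulr_ge0 ?(ltW lam0) ?(ltW x0)//.
  rewrite -[g x]opprK (critical_odd fc) oppr_le0.
  have : g x <= 0 by apply: g_le0; lra.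
  rewrite le_eqVlt => /predU1P[->|gx]; first by rewrite oppr0 (critical_at0 fc).
  by apply/ltW/(critical_gt0 fc); rewrite oppr_gt0.
have g_ge t : r1 <= t < r2 -> - g t <= P r1 * - ln r1.
  move=> tr.
  have mono : g r1 + P r1 * ln r1 <= g t + P r1 * ln t.
    apply: (@nondecreasing_from _ (fun x => g x + P r1 * ln x)); [lra|lra|].
    move=> x x0 xr; have x1 : 0 < x < 1 by lra.
    have dg := flow_g fl x1; have dl := is_derive1_ln x0.
    exists ((P r1 - P x) / x); first by der; field; lra.
    by rewrite divr_ge0 ?(ltW x0)// subr_ge0; apply: P_le; lra.
  have : P r1 * ln t <= 0 by apply: mulr_ge0_le0; [exact: ltW|apply: ln_le0; lra].
  by move: mono; rewrite g_r1; lra.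
have hM : P r1 * - ln r1 <= M.
  have high := first_bump_high.
  have := exit_flux_log fc fl r1_itv g_gt0 g_r1 high lam_le1.
  by rewrite /amplitude_bound; lra.
rewrite -oppr_gt0.
apply: (@weak_load_end_gt0 _ lam (slope_bound c M) r1 r2 (fun t => - g t) P
  (fun t => f (- g t))) => //.
- by lra.
- by lra.
- exact: ltW.
- exact: expR_ge0.
- by move=> t; apply: cvgN; exact: cg.
- exact: ltW.
- by lra.
- move=> t t0 tr; have t1 : 0 < t < 1 by lra.
  by have dg := flow_g fl t1; der; field; lra.
- move=> t t0 tr; have t1 : 0 < t < 1 by lra.
  apply: is_derive_eq (flow_P fl t1) _.
  by rewrite (critical_odd fc); ring.
- by move=> t /g_le0; rewrite oppr_ge0.
- by move=> t /g_lt0; rewrite oppr_gt0.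
move=> t tr; have gt0 := g_le0 t tr; have gt1 := g_ge t tr.
have [->|n] := eqVneq (g t) 0; first by rewrite oppr0 (critical_at0 fc) mulr0.
apply: (critical_linear fc); apply/andP; split; last by apply: le_trans gt1 hM.
by rewrite oppr_gt0 lt_neqAle n.
Qed.

End nodal_flow.

(** * The nonlinearity of the problem *)

Definition nonlinearity (R : realType) (alpha beta u : R) : R :=
  u * expR (u ^+ 2 + alpha * (`|u| `^ beta)).

(** [beta <= 1] enters through [u^beta <= u] and [u^(beta - 1) <= 1] for
    [u >= 1]. *)
Lemma nonlinearity_critical (R : realType) (alpha beta : R) :
  0 < alpha -> 0 < beta <= 1 ->
  critical_growth (1 + alpha) (nonlinearity alpha beta).
Proof.
move=> a0 b01.
have powR_le (u : R) : 1 <= u -> u `^ beta <= u.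
  move=> u1; rewrite -[leRHS]powRr1; last by lra.
  by apply: ler_powR => //; lra.
split.
- by lra.
- by move=> u u0; rewrite mulr_gt0// expR_gt0.
- by move=> u; rewrite /nonlinearity normrN sqrrN mulNr.
- move=> u u1; have u0 : 0 < u by lra.
  exists (u^-1 + 2 * u + alpha * (beta * u `^ (beta - 1))).
    have i0 : 0 < u^-1 by rewrite invr_gt0.
    have i1 : u^-1 <= 1 by rewrite invf_le1.
    have p0 : 0 <= u `^ (beta - 1) by exact: powR_ge0.
    have p1 : u `^ (beta - 1) <= 1.
      by rewrite -[leRHS](powRr0 u); apply: ler_powR => //; lra.
    have bp0 : 0 <= beta * u `^ (beta - 1) by apply: mulr_ge0 => //; lra.
    have bp1 : beta * u `^ (beta - 1) <= 1.
      by rewrite -[leRHS]mulr1; apply: ler_pM => //; lra.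
    have := ler_wpM2l (ltW a0) bp1; have := mulr_ge0 (ltW a0) bp0.
    by lra.
  have near_eq : \forall t \near u,
      t * expR (t ^+ 2 + alpha * (t `^ beta)) = nonlinearity alpha beta t.
    near=> t; rewrite /nonlinearity ger0_norm// ltW//.
    by near: t; exact: lt_nbhsr.
  apply: (near_eq_is_derive near_eq); have dp := is_derive1_powR beta u0.
  by der; rewrite /nonlinearity ger0_norm ?(ltW u0)//; field; lra.
- move=> u u1; rewrite /nonlinearity ger0_norm; last by lra.
  apply: (@le_trans _ _ (expR u * expR (u ^+ 2 + alpha * u))).
    apply: ler_pM; rewrite ?expR_ge0//; first by lra.
      by have := expR_ge1Dx u; lra.
    by rewrite ler_expR lerD2l ler_wpM2l ?powR_le// ltW.
  by rewrite -expRD ler_expR; lra.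
- move=> M u uM; rewrite /slope_bound /nonlinearity ger0_norm; last by lra.
  rewrite mulrC ler_wpM2r ?ler_expR//; first by lra.
  have : u `^ beta <= M + 1.
    have [u1|u1] := leP 1 u; first by apply: le_trans (powR_le u u1) _; lra.
    apply: (@le_trans _ _ (1 `^ beta)); last by rewrite powR1; lra.
    by apply: ge0_ler_powR; rewrite ?nnegrE; lra.
  move=> /(ler_wpM2l (ltW a0)).
  have : u ^+ 2 <= M ^+ 2 by rewrite lerXn2r ?nnegrE; lra.
  by lra.
Unshelve. all: by end_near. Qed.

(** * From the disk to the radius *)

Section planar.
Variable R : realType.
Implicit Types (u : R * R -> R) (x y r t : R).

Lemma derive_along_x u x y : derivable u (x, y) (1, 0) ->
  is_derive x 1 (fun t => u (t, y)) (dx u (x, y)).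
Proof.
have E : (fun h : R =>
    h^-1 *: (((fun t => u (t, y)) \o shift x) (h *: 1) - u (x, y)))
    = (fun h : R => h^-1 *: ((u \o shift (x, y)) (h *: (1, 0)) - u (x, y))).
  apply/funext => h /=; congr (_ *: (u (_, _) - _)).
  by rewrite /= /GRing.scale/= mulr0 add0r.
by move=> du; apply: DeriveDef; rewrite /derivable /dx /derive /= ?E.
Qed.

Lemma derive_along_y u x y : derivable u (x, y) (0, 1) ->
  is_derive y 1 (fun t => u (x, t)) (dy u (x, y)).
Proof.
have E : (fun h : R =>
    h^-1 *: (((fun t => u (x, t)) \o shift y) (h *: 1) - u (x, y)))
    = (fun h : R => h^-1 *: ((u \o shift (x, y)) (h *: (0, 1)) - u (x, y))).
  apply/funext => h /=; congr (_ *: (u (_, _) - _)).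
  by rewrite /= /GRing.scale/= mulr0 add0r.
by move=> du; apply: DeriveDef; rewrite /derivable /dy /derive /= ?E.
Qed.

Lemma enorm_x r : 0 <= r -> enorm (r, 0) = r.
Proof. by move=> r0; rewrite /enorm /= expr0n /= addr0 sqrtr_sqr ger0_norm. Qed.

Lemma enorm_derive r t : 0 < r ->
  is_derive t 1 (fun t => enorm (r, t)) (t / enorm (r, t)).
Proof.
move=> r0; have q0 : 0 < r ^+ 2 + t ^+ 2.
  by rewrite ltr_wpDr ?sqr_ge0// exprn_gt0.
have dq : is_derive t 1 (fun s => r ^+ 2 + s ^+ 2) (2 * t).
  by der; ring.
have d := @is_derive_compf _ Num.sqrt (fun s => r ^+ 2 + s ^+ 2) t _ _
  (is_derive1_sqrt q0) dq.
rewrite /enorm /=; apply: (is_derive_eq d).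
by field; rewrite gt_eqF// sqrtr_gt0.
Qed.

Lemma enorm_near r t : 0 < r -> enorm (r, t) < 1 ->
  \forall s \near t, enorm (r, s) < 1.
Proof.
move=> r0 rt; have /is_derive_continuous c := enorm_derive t r0.
exact: (cvgr_lt (enorm (r, t)) c).
Qed.

Lemma radial_derive_y u r t : Ck_on disk 2 u -> radial u ->
  0 < r -> enorm (r, t) < 1 ->
  dy u (r, t) = dx u (enorm (r, t), 0) * (t / enorm (r, t)).
Proof.
move=> [_ [ux uy _ _]] rad r0 rt.
have rho0 (s : R) : 0 <= enorm (r, s) by exact: sqrtr_ge0.
have d1 := derive_along_y (uy (r, t) rt).
have near_eq : \forall s \near t, u (enorm (r, s), 0) = u (r, s).
  near=> s; have rs : enorm (r, s) < 1 by near: s; exact: enorm_near.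
  by apply: rad; rewrite /cdisk /= ?enorm_x// ltW.
have ux' : disk (enorm (r, t), 0) by rewrite /disk /= enorm_x.
have d2 := @is_derive_compf _ (fun s => u (s, 0)) (fun s => enorm (r, s)) _ _ _
  (derive_along_x (ux _ ux')) (enorm_derive t r0).
have [_ <-] := near_eq_is_derive near_eq d2.
by have [_ ->] := d1.
Unshelve. all: by end_near. Qed.

(** For a radial function the derivative in [y] at [(r, t)] is the radial
    derivative times [t / enorm (r, t)]; the second factor vanishes on the axis,
    so only its own derivative [1 / r] contributes there. *)
Lemma radial_derive_yy u r : Ck_on disk 2 u -> radial u -> 0 < r < 1 ->
  dy (dy u) (r, 0) = dx u (r, 0) / r.
Proof.
move=> uC rad r01; have [_ [ux uy dxC dyC]] := uC.
have r0 : 0 < r by lra.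
have er : enorm (r, 0) = r by rewrite enorm_x; lra.
have [_ [uxx _ _ _]] := dxC; have [_ [_ uyy _ _]] := dyC.
have r0d : disk (r, 0) by rewrite /disk /= er; lra.
have d1 := derive_along_y (uyy _ r0d).
have dxx := derive_along_x (uxx _ r0d).
have de := enorm_derive 0 r0.
have near_eq : \forall s \near (0 : R),
    dx u (enorm (r, s), 0) * (s * (enorm (r, s))^-1) = dy u (r, s).
  near=> s; have rs : enorm (r, s) < 1.
    by near: s; apply: enorm_near => //; rewrite er; lra.
  by rewrite (radial_derive_y uC).
have e0 : enorm (r, 0) != 0 by rewrite er; lra.
have dxe : is_derive (0 : R) 1 (fun s => dx u (enorm (r, s), 0))
    (dx (dx u) (r, 0) * (0 / enorm (r, 0))).
  apply: (@is_derive_compf _ (fun t => dx u (t, 0)) (fun s => enorm (r, s)) _ _ _ _ de).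
  by rewrite er.
have di := @is_derive_invf _ (fun s => enorm (r, s)) 0 _ e0 de.
have d2 := is_derive_mulf dxe (is_derive_mulf (is_derive_idf 0) di).
have [_ <-] := d1; have [_ ->] := near_eq_is_derive near_eq d2.
by rewrite er; field; lra.
Unshelve. all: by end_near. Qed.

End planar.

Section ray.
Variable R : realType.
Implicit Types (u v : R * R -> R) (a b r s x : R).

Lemma pair0_continuous x : {for x, continuous (fun t : R => (t, 0 : R))}.
Proof.
have ci : (fun t : R => t) @ x --> x by exact: cvg_id.
have c0 : (fun _ : R => 0 : R) @ x --> (0 : R) by exact: cvg_cst.
exact: (cvg_pair ci c0).
Qed.

Lemma ray_continuous v x : {for (x, 0), continuous v} ->
  {for x, continuous (fun t => v (t, 0))}.
Proof. exact: (continuous_comp (@pair0_continuous x)). Qed.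

Lemma ray_continuous_within u a b : 0 <= a -> b <= 1 ->
  {within cdisk, continuous u} ->
  {within `[a, b], continuous (fun t => u (t, 0))}.
Proof.
move=> a0 b1 /subspace_continuousP cu; apply/subspace_continuousP => x /= xab.
have seg (t : R) : t \in `[a, b] -> cdisk (t, 0).
  by rewrite in_itv /= => tab; rewrite /cdisk /= enorm_x; lra.
apply: cvg_trans (cu (x, 0) (seg x xab)).
move=> A /= uA.
have near_A : \forall t \near x, cdisk (t, 0 : R) -> A (u (t, 0)).
  exact: (@pair0_continuous x _ uA).
change (\forall t \near x, t \in `[a, b] -> A (u (t, 0))).
near=> t => tab.
have tA : cdisk (t, 0 : R) -> A (u (t, 0)) by near: t.
exact: tA (seg t tab).
Unshelve. all: by end_near. Qed.

(** The sign [s] serves to make the solution positive at the origin; it passes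
    through the equation because the nonlinearity is odd. *)
Lemma solution_flow (alpha beta lam s : R) u : 0 < lam -> s = 1 \/ s = -1 ->
  solution alpha lam beta u -> radial u ->
  flow (nonlinearity alpha beta) lam
    (fun r => s * u (r, 0)) (fun r => - (r * (s * dx u (r, 0)))).
Proof.
move=> lam0 s1 [uC _ ueq _] rad; have [u_cont [ux _ [dx_cont [uxx _ _ _]] _]] := uC.
have disk_x r : 0 <= r < 1 -> disk (r, 0) by move=> r01; rewrite /disk /= enorm_x; lra.
have disk0 : disk (0 : R, 0 : R) by apply: disk_x; lra.
have c_u := ray_continuous (u_cont _ disk0).
have c_dx := ray_continuous (dx_cont _ disk0).
split; first exact: lam0.
- by rewrite mul0r oppr0.
- exact: (continuous_mulf (continuous_cstf _ _) c_u).
- apply: continuous_oppf; apply: (continuous_mulf (continuous_idf _)).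
  exact: (continuous_mulf (continuous_cstf _ _) c_dx).
- move=> r r01; have rd : disk (r, 0) by apply: disk_x; lra.
  by have du := derive_along_x (ux _ rd); der; field; lra.
- move=> r r01; have rd : disk (r, 0) by apply: disk_x; lra.
  have du := derive_along_x (uxx _ rd).
  have f_odd : nonlinearity alpha beta (s * u (r, 0)) =
      s * nonlinearity alpha beta (u (r, 0)).
    by case: s1 => ->; rewrite ?mul1r// !mulN1r /nonlinearity normrN sqrrN mulNr.
  rewrite f_odd; der.
  have := ueq _ rd; rewrite /laplacian (radial_derive_yy uC rad r01).
  rewrite -mulrA -/(nonlinearity alpha beta (u (r, 0))) => E.
  have -> : lam * r * (s * nonlinearity alpha beta (u (r, 0))) =
            r * s * (lam * nonlinearity alpha beta (u (r, 0))) by ring.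
  by rewrite -E; field; lra.
Qed.

(** Indices [0] and [1] of the nodal decomposition exist because [k > 0]; below
    the threshold [second_bump_persists] forbids the zero at [r 2]. *)
Lemma nodal_lambda_lower_bound (alpha beta lam : R) (k : nat) u :
  0 < alpha -> 0 < beta <= 1 -> 0 < lam <= 1 -> (0 < k)%N ->
  S_ alpha k lam beta u ->
  2 < lam * slope_bound (1 + alpha) (amplitude_bound (1 + alpha)).
Proof.
move=> a0 b01 lam01 k0 [usol rad [r [r0 rk r_lt u_zero u_sign]]].
rewrite ltNge; apply/negP => small.
have lam0 : 0 < lam by lra.
have r_le1 i : (i <= k)%N -> r i.+1 <= 1.
  move=> ik; rewrite -rk; elim: k ik r_lt {k0 u_zero u_sign rk} => [|k IH] ik r_lt.
    by move: ik; rewrite leqn0 => /eqP->.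
  move: ik; rewrite leq_eqVlt => /predU1P[->//|ik].
  apply: (le_trans (IH ik _)); first by move=> j jk; apply: r_lt; exact: leqW.
  by apply/ltW/r_lt.
have r01 : 0 < r 1%N by rewrite -r0; exact: r_lt.
have r12 : r 1%N < r 2%N by exact: r_lt.
have r2 : r 2%N <= 1 by exact: r_le1.
pose s : R := Num.sg (u (0, 0)).
have u0 : u (0, 0) != 0.
  apply/eqP => u00; have := u_sign 0%N (r 1%N / 2, 0) isT.
  by rewrite u00 sgr0 !mul0r ltxx r0 enorm_x => [H|]; [have := H _; lra|lra].
have s1 : s = 1 \/ s = -1.
  by rewrite /s; case: sgrP u0 => // _ _; [left|right].
have fl := solution_flow lam0 s1 usol rad.
have fc := nonlinearity_critical a0 b01.
have [_ u_within _ _] := usol.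
have neg : s * u (r 2%N, 0) < 0.
  apply: (@second_bump_persists _ _ _ _ _ _ (r 1%N) fc fl) => //.
  - by lra.
  - move=> t tr; have [t0|t_n0] := eqVneq t 0.
      by rewrite t0 /s -normrEsg normr_gt0.
    have := u_sign 0%N (t, 0) isT; rewrite expr0 mulr1; apply.
    by rewrite r0 enorm_x; lra.
  - by rewrite (u_zero 0%N (r 1%N, 0) isT) ?mulr0// enorm_x; lra.
  - by lra.
  - by lra.
  - have cu : {within `[r 1%N, r 2%N], continuous (fun t => u (t, 0))}.
      by apply: ray_continuous_within => //; lra.
    by move=> t; apply: cvgM; [exact: cvg_cst|exact: cu].
  - move=> t tr; have := u_sign 1%N (t, 0) k0; rewrite expr1 enorm_x; last by lra.
    by rewrite -/s mulrN1 mulNr oppr_gt0; apply.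
by move: neg; rewrite (u_zero 1%N (r 2%N, 0) k0) ?mulr0 ?ltxx// enorm_x; lra.
Qed.
End ray.

(** * Nonexistence *)

Unset Implicit Arguments.

Theorem corollary1p2 (R : realType) (alpha : R) (halpha : 0 < alpha)
    (k : nat) (hk : (0 < k)%N)
    (lambda beta : nat -> R) (lambda_s beta_s : R)
    (hlambda : forall n, 0 < lambda n)
    (hbeta : forall n, 0 < beta n <= 1)
    (hlambda_s : lambda_s = 0)
    (hbeta_s : 0 < beta_s <= 1)
    (hlim : (lambda n, beta n) @[n --> \oo] --> (lambda_s, beta_s)) :
  ~ exists u : nat -> (R * R -> R),
      (forall n, S_ alpha k (lambda n) (beta n) (u n)) /\
      (exists M : R, forall n, (dirichlet (u n) <= M%:E)%E).
Proof.
move=> [u [uS _]].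
pose L := slope_bound (1 + alpha) (amplitude_bound (1 + alpha)).
have L0 : 0 < L by exact: expR_gt0.
have lambda0 : lambda n @[n --> \oo] --> (0 : R).
  by rewrite -hlambda_s; exact: (cvg_comp _ _ hlim cvg_fst).
have [n [n1 nL]] : exists n, lambda n < 1 /\ lambda n < 2 / L.
  have near1 : \forall n \near \oo, lambda n < 1 /\ lambda n < 2 / L.
    near=> n; split; near: n; apply: (cvgr_lt 0 lambda0) => //.
    exact: divr_gt0.
  by have [n _ /(_ n (leqnn n)) nP] := near1; exists n.
have ln01 : 0 < lambda n <= 1 by rewrite hlambda ltW.
have := nodal_lambda_lower_bound halpha (hbeta n) ln01 hk (uS n).
by move: nL; rewrite ltr_pdivlMr// -/L => nL /(lt_trans nL); rewrite ltxx.
Unshelve. all: by end_near. Qed.
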